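(* Let $p$ be a prime and let $r_p := p^{-\frac{1}{p-1}}$. The series $$W_p(x)=\sum_{n=1}^\infty\frac{(-n)^{n-1}}{n!}x^n$$ defining $W_p$ is convergent whenever $x\in\Omega_p$ is such that $|x|_p<r_p$, and it is divergent elsewhere. Moreover, $$|W_p(x)|_p=|x|_p\qquad(|x|_p<r_p).$$ Thus $W_p$ has no zeros on its domain of definition except $x=0$. For the growth modulus we have that $$M_r(W_p):=\max_{n\ge1}\left|\frac{(-n)^{n-1}}{n!}\right|_p r^n=r\qquad(0<r<r_p),$$ and $W_p$ has no critical radius.
   Context: $\Omega_p$ denotes the algebraically and topologically closed (and spherically complete) $p$-adic field for the prime $p$, with $p$-adic absolute value $|\cdot|_p$ normalized by $|p|_p=p^{-1}$. The $p$-adic Lambert function $W_p$ is the function on a part of $\Omega_p$ satisfying $W_p(x)\exp_p(W_p(x))=x$, where $\exp_p(x)=\sum_{n\ge0}x^n/n!$ is the $p$-adic exponential; it is represented by the series in the claim, which is the same Taylor series as that of the classical Lambert $W$ function. A critical radius of a function $f(x)=\sum_{n\ge0}a_nx^n$ is a positive real number $r$ such that $|a_n|_p\cdot r^n=|a_m|_p\cdot r^m$ for some $n,m$ such that $n\neq m$.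
   Formalization: A critical radius is here one where two distinct monomials tie and dominate all others (value M_r); with mere ties the claim fails for every p: r=p^(1-p) ties degrees p and p+1 (p odd), r=2^(-6) ties degrees 4 and 5 (p=2). *)

(* Defs.v *)
From HB Require Import structures.
From mathcomp Require Import all_boot all_order all_algebra.
From mathcomp Require Import all_classical all_reals all_analysis.
Set Implicit Arguments.
Unset Strict Implicit.
Unset Printing Implicit Defensive.
Import Order.TTheory GRing.Theory Num.Theory.
Import numFieldNormedType.Exports.
Local Open Scope classical_set_scope.
Local Open Scope ring_scope.

(* The absolute value is not made into a norm of a [normedZmodType]: the axiom
   |x *+ n| = |x| *+ n of that structure excludes ultrametric norms. *)
Record ultraClosedField (R : realType) := UltraClosedField {
  ultra_field : closedFieldType;
  ultra_abs : ultra_field -> R;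
  ultra_abs_ge0 : forall x, 0 <= ultra_abs x;
  ultra_abs_eq0 : forall x, ultra_abs x = 0 <-> x = 0;
  ultra_absM : forall x y, ultra_abs (x * y) = ultra_abs x * ultra_abs y;
  ultra_absD : forall x y,
    ultra_abs (x + y) <= Num.max (ultra_abs x) (ultra_abs y)
}.

(* The metric and topological structures |x - y| induces on the field are
   declared on this alias. *)
Definition ultra_carrier (R : realType) (K : ultraClosedField R) : Type :=
  ultra_field K.
Coercion ultra_carrier : ultraClosedField >-> Sortclass.

HB.instance Definition _ (R : realType) (K : ultraClosedField R) :=
  GRing.ClosedField.copy (ultra_carrier K) (ultra_field K).

Definition vabs (R : realType) (K : ultraClosedField R) (x : K) : R :=
  ultra_abs x.

Notation "|| x ||_p" := (vabs x)
  (at level 0, x at level 99, format "|| x ||_p") : ring_scope.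

Section UltraMetric.
Variables (R : realType) (K : ultraClosedField R).

Let dist (x y : K) : R := ||x - y||_p.

Let dist_xx x : dist x x = 0.
Proof. by apply/ultra_abs_eq0; rewrite subrr. Qed.

Let dist_eq0 x y : dist x y = 0 -> x = y.
Proof. by move/ultra_abs_eq0/eqP; rewrite subr_eq0 => /eqP. Qed.

Let vabs1 : ||1 : K||_p = 1.
Proof.
have n0 : ||1 : K||_p != 0.
  by apply/eqP => /ultra_abs_eq0 /eqP; rewrite oner_eq0.
by apply: (mulfI n0); rewrite -[LHS]ultra_absM !mulr1.
Qed.

Let vabsN (x : K) : ||- x||_p = ||x||_p.
Proof.
have N1 : ||-1 : K||_p = 1.
  apply/eqP; rewrite -(@pexpr_eq1 _ _ 2) ?ultra_abs_ge0// expr2.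
  by rewrite -[X in X == _]ultra_absM mulrNN mulr1 -vabs1.
by rewrite -mulN1r [LHS]ultra_absM -/(vabs _) N1 mul1r.
Qed.

Let dist_sym x y : dist x y = dist y x.
Proof. by rewrite /dist -opprB vabsN. Qed.

Let dist_triangle y x z : dist x z <= dist x y + dist y z.
Proof.
rewrite /dist -[x - z](subrKA y).
apply: (le_trans (ultra_absD _ _)).
by rewrite ge_max lerDl lerDr !ultra_abs_ge0.
Qed.

HB.instance Definition _ := isMetric.Build R (ultra_carrier K)
  dist_xx dist_eq0 dist_sym dist_triangle.
HB.instance Definition _ := isPointed.Build (ultra_carrier K) 0.

End UltraMetric.

(* Models of Omega_p.  Characteristic 0 and the embedding of Q_p follow from
   these properties.  The balls are spelled out through
   [closed_ball_ f c r = [set y | f (c - y) <= r]] because the library's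
   [closed_ball c r], the closure of the open ball, is here the open ball. *)
Record padicOmega (p : nat) (R : realType) := PadicOmega {
  padic_field :> ultraClosedField R;
  padic_abs_p : ||p%:R : padic_field||_p = p%:R^-1;
  padic_complete : forall F : set_system padic_field,
    ProperFilter F -> cauchy F -> cvg F;
  padic_spherically_complete : forall (c : nat -> padic_field) (r : nat -> R),
    (forall n, 0 < r n) ->
    (forall n, closed_ball_ (@vabs R padic_field) (c n.+1) (r n.+1)
                 `<=` closed_ball_ (@vabs R padic_field) (c n) (r n)) ->
    \bigcap_n closed_ball_ (@vabs R padic_field) (c n) (r n) !=set0
}.

Section PadicLambert.
Variables (p : nat) (R : realType) (K : padicOmega p R).

Definition padic_radius : R := p%:R `^ (- (p%:R - 1)^-1).

Definition power_series (a : nat -> K) (x : K) : nat -> K :=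
  series (fun n => a n * x ^+ n).

(* The Lambert series starts at n = 1.  The constant coefficient is set to 0
   separately because the formula would give (-0)^(0-1)/0! = 1 at n = 0 with
   truncated subtraction. *)
Definition lambert_coef (n : nat) : K :=
  if n == 0%N then 0 else (- n%:R) ^+ n.-1 / (n`!)%:R.

(* [limn] is meaningful only where the series converges. *)
Definition lambertW (x : K) : K := limn (power_series lambert_coef x).

Definition is_max (A : set R) (m : R) : Prop := A m /\ ubound A m.

(* A critical radius is one at which two distinct monomials are tied *and
   dominant*.  Without dominance the notion is of no use: r = p^(1-p) ties the
   monomials of degrees p and p+1 of the Lambert series, both of them being
   strictly smaller than the one of degree 1. *)
Definition critical_radius (a : nat -> K) (r : R) : Prop :=
  0 < r /\
  exists n m : nat, [/\ n <> m,
    ||a n||_p * r ^+ n = ||a m||_p * r ^+ m &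
    forall k : nat, ||a k||_p * r ^+ k <= ||a n||_p * r ^+ n].

End PadicLambert.

Arguments padic_radius : clear implicits.
Arguments lambert_coef {p R} K n.

(* Main.v *)
Require Import Defs.
From mathcomp Require Import all_boot all_order all_algebra.
From mathcomp Require Import all_classical all_reals all_analysis.
Set Implicit Arguments.
Unset Strict Implicit.
Unset Printing Implicit Defensive.
Import Order.TTheory GRing.Theory Num.Theory.
Import numFieldNormedType.Exports.
Local Open Scope classical_set_scope.
Local Open Scope ring_scope.

(** Write [rho] for the radius and [v] for the [p]-adic valuation of an
    integer, so that [|m| = rho ^ ((p - 1) v(m))] for every integer [m > 0].
    For [n >= 1] the coefficient [a_n] then satisfies
      [|a_n| rho ^ (n - 1) = |n| ^ (n - 1) * rho ^ (n - 1 - (p - 1) v(n!))],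
    and Legendre's bound [(p - 1) v(n!) <= n - 1] makes both factors at most 1.
    For [n >= 2] the product is even strictly smaller than 1
    ([vabs_lambert_coef_lt1]): the first factor is when [p] divides [n], and
    otherwise the second one is, because [v(n!) = v((n - 1)!)].

    Hence at every radius [0 < r <= rho] the monomial of degree 1, of size [r],
    strictly dominates all the others; this gives the growth modulus and, by
    the ultrametric inequality, [|W(x)| = |x|].  Below [rho] the terms decrease
    geometrically, and in a complete ultrametric field this suffices for
    convergence.

    Conversely Legendre's bound is attained at [p ^ k], so the indices
    [n = p ^ k + 1] give [|a_n| rho ^ n >= rho ^ 2]
    ([vabs_lambert_coef_pow_succ]).  The terms therefore do not tend to 0 when
    [|x| >= rho], and they are unbounded at a radius [r > rho], where no
    monomial can be dominant. *)

(** * The valuation of a factorial *)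

(** Induction on the number of terms of Legendre's formula: the first term is
    [n / p] and the others form the sum for [n / p].  The number [N] of terms is
    independent of [n] so that the induction can change [n] into [n / p]. *)
Lemma legendre_sum_ub (p N n : nat) : (1 < p)%N -> (0 < n)%N ->
  (p.-1 * \sum_(1 <= k < N.+1) n %/ p ^ k <= n.-1)%N.
Proof.
move=> p1; elim: N n => [|N IH] n n0; first by rewrite big_geq// muln0.
rewrite big_nat_recl// expn1.
under eq_bigr do rewrite expnS divnMA.
have [q0|q0] := posnP (n %/ p)%N.
  by rewrite q0 big1 ?addn0 ?muln0// => i _; rewrite div0n.
rewrite mulnDr (leq_trans (leq_add (leqnn _) (IH _ q0)))//.
rewrite -ltnS prednK// -addnS prednK// -mulSnr prednK ?(ltnW p1)//.
by rewrite mulnC leq_trunc_div.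
Qed.

Lemma logn_fact_ub (p n : nat) : prime p -> (0 < n)%N ->
  (p.-1 * logn p n`! <= n.-1)%N.
Proof.
by move=> pp n0; rewrite logn_fact// legendre_sum_ub// prime_gt1.
Qed.

(** For such [n] the factor [n] does not contribute to [v(n!)], so the bound for
    [(n - 1)!] applies. *)
Lemma logn_fact_ub_strict (p n : nat) : prime p -> (1 < n)%N -> ~~ (p %| n)%N ->
  (p.-1 * logn p n`! < n.-1)%N.
Proof.
case: n => [|[|n]]// pp _ pn; rewrite factS lognM ?fact_gt0//.
rewrite logn_coprime ?prime_coprime// add0n ltnS.
exact: (@logn_fact_ub p n.+1).
Qed.

Lemma logn_fact_pow_lb (p k : nat) : prime p ->
  ((p ^ k).-1 <= p.-1 * logn p (p ^ k)`!)%N.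
Proof.
move=> pp; have p0 := prime_gt0 pp.
rewrite logn_fact// predn_exp leq_mul2l; apply/orP; right.
have kpk : (k.+1 <= (p ^ k).+1)%N by rewrite ltnS ltnW// ltn_expl// prime_gt1.
rewrite (big_cat_nat _ (n := k.+1))//= (leq_trans _ (leq_addr _ _))//.
rewrite big_add1/= big_nat_rev/= big_mkord; apply: leq_sum => i _.
by rewrite add0n subnSK// -expnB ?leq_subr// subKn// ltnW.
Qed.

(** * Ultrametric absolute values *)

Section Ultrametric.
Variables (R : realType) (K : ultraClosedField R).
Implicit Types x y : K.

Lemma vabs_ge0 x : 0 <= ||x||_p. Proof. exact: ultra_abs_ge0. Qed.

Lemma vabs0 : ||0 : K||_p = 0. Proof. exact/ultra_abs_eq0. Qed.

Lemma vabs0_eq0 x : ||x||_p = 0 -> x = 0. Proof. by move/ultra_abs_eq0. Qed.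

Lemma vabsM x y : ||x * y||_p = ||x||_p * ||y||_p.
Proof. exact: ultra_absM. Qed.

Lemma vabsD_le_max x y : ||x + y||_p <= Num.max ||x||_p ||y||_p.
Proof. exact: ultra_absD. Qed.

Lemma vabs1 : ||1 : K||_p = 1.
Proof.
have n0 : ||1 : K||_p != 0 by apply/eqP => /vabs0_eq0/eqP; rewrite oner_eq0.
by apply: (mulfI n0); rewrite -vabsM !mulr1.
Qed.

Lemma vabsX x n : ||x ^+ n||_p = ||x||_p ^+ n.
Proof.
by elim: n => [|n IH]; rewrite ?expr0 ?vabs1// !exprS vabsM IH.
Qed.

Lemma vabsN x : ||- x||_p = ||x||_p.
Proof.
rewrite -mulN1r vabsM; suff -> : ||-1 : K||_p = 1 by rewrite mul1r.
by apply/eqP; rewrite -(@pexpr_eq1 _ _ 2) ?vabs_ge0// -vabsX sqrrN expr1n vabs1.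
Qed.

Lemma vabsB x y : ||x - y||_p = ||y - x||_p.
Proof. by rewrite -vabsN opprB. Qed.

Lemma vabsV x : ||x^-1||_p = ||x||_p^-1.
Proof.
have [->|x0] := eqVneq x 0; first by rewrite invr0 vabs0 invr0.
have a0 : ||x||_p != 0 by apply: contraNneq x0 => /vabs0_eq0 ->.
by apply: (mulfI a0); rewrite -vabsM !divff// vabs1.
Qed.

Lemma vabsD_lt x y (c : R) : ||x||_p < c -> ||y||_p < c -> ||x + y||_p < c.
Proof.
by move=> xc yc; rewrite (le_lt_trans (vabsD_le_max _ _))// gt_max xc.
Qed.

Lemma vabs_sum_lt (I : Type) (s : seq I) (P : pred I) (F : I -> K) (c : R) :
  0 < c -> (forall i, P i -> ||F i||_p < c) ->
  ||\sum_(i <- s | P i) F i||_p < c.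
Proof.
move=> c0 Fc; elim/big_ind : _ => //; first by rewrite vabs0.
by move=> x y; exact: vabsD_lt.
Qed.

(** All triangles are isosceles: both [|x + y| <= |x|] and
    [|x| = |(x + y) - y| <= max |x + y| |y|] hold. *)
Lemma vabsD_isosceles x y : ||y||_p < ||x||_p -> ||x + y||_p = ||x||_p.
Proof.
move=> yx; apply/eqP; rewrite eq_le; apply/andP; split.
  by rewrite (le_trans (vabsD_le_max _ _))// ge_max lexx ltW.
have := vabsD_le_max (x + y) (- y).
by rewrite addrK vabsN le_max (leNgt ||x||_p ||y||_p) yx orbF.
Qed.

Lemma vabs_nat_le1 (n : nat) : ||n%:R : K||_p <= 1.
Proof.
elim: n => [|n IH]; first by rewrite vabs0.
by rewrite -natr1 (le_trans (vabsD_le_max _ _))// ge_max IH vabs1/=.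
Qed.

Lemma vabs_cvgP (u : nat -> K) (l : K) :
  u @ \oo --> l <->
  forall e, 0 < e -> exists N, forall n, (N <= n)%N -> ||l - u n||_p < e.
Proof.
split=> [/cvg_ballP ul e /ul[N _ Nu]|ul].
  by exists N => n Nn; have := Nu n Nn.
by apply/cvg_ballP => e /ul[N Nu]; exists N.
Qed.

Lemma cvgn_series_vabs_lt (u : nat -> K) : cvgn (series u) ->
  forall e, 0 < e -> exists N, forall n, (N <= n)%N -> ||u n||_p < e.
Proof.
move=> /vabs_cvgP cu e /cu[N Nu]; exists N => n Nn.
have -> : u n =
    (series u n.+1 - limn (series u)) + (limn (series u) - series u n).
  by rewrite subrKA /series/= big_nat_recr//= addrAC subrr add0r.
by apply: vabsD_lt; [rewrite vabsB|]; apply: Nu => //; rewrite ltnW.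
Qed.

(** By the ultrametric inequality a section of the series is as small as its
    largest term, so terms tending to 0 already make the partial sums Cauchy. *)
Lemma vabs_lt_cvgn_series (u : nat -> K) :
  (forall F : set_system K, ProperFilter F -> cauchy F -> cvg F) ->
  (forall e, 0 < e -> exists N, forall n, (N <= n)%N -> ||u n||_p < e) ->
  cvgn (series u).
Proof.
move=> complete u0; apply: complete; apply: cauchy_exP => e e0.
have [N Nu] := u0 e e0; exists (series u N), N => // n /= Nn.
suff : ||series u N - series u n||_p < e by [].
rewrite vabsB /series/= (big_cat_nat _ (n := N))//= addrAC subrr add0r.
rewrite big_seq_cond; apply: vabs_sum_lt => // i.
by rewrite mem_index_iota andbT => /andP[Ni _]; exact: Nu.
Qed.

(** Once [|l - u n| < e] the values [|l|] and [|u n|] differ by less than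
    [e]. *)
Lemma vabs_cvg_cst (u : nat -> K) (l : K) (c : R) (M : nat) :
  u @ \oo --> l -> (forall n, (M <= n)%N -> ||u n||_p = c) -> ||l||_p = c.
Proof.
move=> /vabs_cvgP ul uc; apply/eqP; rewrite eq_le; apply/andP; split;
  apply/ler_addgt0Pl => e /ul[N /(_ _ (leq_maxl N M)) lu];
  have := uc _ (leq_maxr N M); set n := maxn N M in lu * => unc.
- rewrite -(subrK (u n) l) (le_trans (vabsD_le_max _ _))// ge_max unc.
  rewrite ler_wpDr ?(ltW lu) -?unc ?vabs_ge0//= lerDr.
  exact: le_trans (vabs_ge0 _) (ltW lu).
- rewrite -unc -(subrK l (u n)) (le_trans (vabsD_le_max _ _))// ge_max vabsB.
  rewrite ler_wpDr ?(ltW lu) ?vabs_ge0//= lerDr.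
  exact: le_trans (vabs_ge0 _) (ltW lu).
Qed.

End Ultrametric.

Lemma expr_lt_small (R : realType) (z e : R) : 0 <= z -> z < 1 -> 0 < e ->
  exists N, forall n, (N <= n)%N -> z ^+ n < e.
Proof.
move=> z0 z1 e0.
have /cvg_expr/cvgrPdist_lt/(_ e e0)[N _ Nz] : `|z| < 1 by rewrite ger0_norm.
exists N => n Nn; have := Nz n Nn.
by rewrite /= sub0r normrN ger0_norm ?exprn_ge0.
Qed.

(** * The radius of convergence *)

Section Lambert.
Variables (p : nat) (p_prime : prime p) (R : realType) (K : padicOmega p R).

Let rho := padic_radius p R.
Let a := lambert_coef K.

Let p_gt0 : 0 < p%:R :> R. Proof. by rewrite ltr0n prime_gt0. Qed.
Let p1_gt0 : (0 < p.-1)%N. Proof. by rewrite -subn1 subn_gt0 prime_gt1. Qed.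

Lemma padic_radius_gt0 : 0 < rho. Proof. exact: powR_gt0. Qed.

Lemma padic_radiusX : rho ^+ p.-1 = p%:R^-1.
Proof.
have p1E : p%:R - 1 = p.-1%:R :> R by rewrite -subn1 natrB ?prime_gt0.
rewrite /rho /padic_radius p1E -powR_mulrn ?powR_ge0// -powRrM mulNr.
by rewrite mulVf ?pnatr_eq0 -?lt0n// powR_inv1// ltW.
Qed.

Lemma padic_radius_lt1 : rho < 1.
Proof.
have := padic_radius_gt0 => rho0.
rewrite -(expr_lt1 p1_gt0 (ltW rho0)) padic_radiusX invf_lt1//.
by rewrite ltr1n prime_gt1.
Qed.

(** * Absolute values of the coefficients *)

(** If [u n = 1 + v p] then [|u n| = 1], while both factors are at most 1. *)
Lemma vabs_nat_coprime (n : nat) : coprime p n -> ||n%:R : K||_p = 1.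
Proof.
move=> pn; apply/eqP; rewrite eq_le vabs_nat_le1/=.
have n0 : (0 < n)%N.
  by case: n pn => //; rewrite prime_coprime// dvdn0.
case: (egcdnP p n0) => u v Euv _.
have vabs_un : ||(u * n)%:R : K||_p = 1.
  move: pn; rewrite coprime_sym => /eqP gn.
  rewrite Euv gn natrD addrC vabsD_isosceles ?vabs1// natrM vabsM padic_abs_p.
  rewrite (le_lt_trans (ler_piMl _ (vabs_nat_le1 _ _))) ?invr_ge0 ?ltW//.
  by rewrite invf_lt1// ltr1n prime_gt1.
by rewrite -vabs_un natrM vabsM ler_piMl ?vabs_ge0// vabs_nat_le1.
Qed.

Lemma vabs_nat (n : nat) : (0 < n)%N ->
  ||n%:R : K||_p = rho ^+ (p.-1 * logn p n).
Proof.
move=> n0; have [m pm {1}->] := pfactor_coprime p_prime n0.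
rewrite natrM natrX vabsM vabsX vabs_nat_coprime// mul1r padic_abs_p.
by rewrite -padic_radiusX exprM.
Qed.

Lemma lambert_coef0 : a 0 = 0. Proof. by []. Qed.

Lemma lambert_coef1 : a 1 = 1.
Proof. by rewrite /a/lambert_coef/= expr0 divr1. Qed.

Lemma vabs_lambert_coef n : (0 < n)%N ->
  ||a n||_p = ||n%:R : K||_p ^+ n.-1 / ||n`!%:R : K||_p.
Proof.
by case: n => // n _; rewrite /a/lambert_coef/= vabsM vabsX vabsN vabsV.
Qed.

(** The normalization by [rho ^ (n - 1)] absorbs the division by [n!]:
    Legendre's bound makes the exponent of [rho] a natural number. *)
Lemma vabs_lambert_coefX n : (0 < n)%N ->
  ||a n||_p * rho ^+ n.-1 =
  ||n%:R : K||_p ^+ n.-1 * rho ^+ (n.-1 - p.-1 * logn p n`!).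
Proof.
move=> n0; rewrite vabs_lambert_coef// (vabs_nat (fact_gt0 n)) mulrAC -mulrA.
by rewrite expfB_cond// gt_eqF ?padic_radius_gt0//= logn_fact_ub.
Qed.

Lemma vabs_lambert_coef_lt1 n : (1 < n)%N -> ||a n||_p * rho ^+ n.-1 < 1.
Proof.
move=> n1; have n0 := ltnW n1; rewrite vabs_lambert_coefX//.
have rho0 := padic_radius_gt0; have rho1 := padic_radius_lt1.
have n1_neq0 : n.-1 != 0%N by rewrite -lt0n -subn1 subn_gt0.
have [pn|pn] := boolP (p %| n)%N.
- rewrite (le_lt_trans (ler_piMr _ _)) ?exprn_ge0 ?vabs_ge0//.
    by rewrite exprn_ile1// ltW.
  rewrite exprn_ilt1 ?vabs_ge0// vabs_nat// exprn_ilt1 ?(ltW rho0)//.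
  by rewrite muln_eq0 negb_or -!lt0n p1_gt0 logn_gt0 mem_primes p_prime n0 pn.
- rewrite (le_lt_trans (ler_piMl _ _)) ?exprn_ge0 ?(ltW rho0)//.
    by rewrite exprn_ile1 ?vabs_ge0 ?vabs_nat_le1.
  rewrite exprn_ilt1 ?(ltW rho0)// -lt0n subn_gt0.
  exact: logn_fact_ub_strict.
Qed.

(** At these indices [n] is prime to [p] and [(p - 1) v(n!) = n - 2]. *)
Lemma vabs_lambert_coef_pow_succ k : (0 < k)%N ->
  rho ^+ 2 <= ||a (p ^ k).+1||_p * rho ^+ (p ^ k).+1.
Proof.
move=> k0; have rho0 := padic_radius_gt0; have rho1 := padic_radius_lt1.
rewrite [rho ^+ (p ^ k).+1]exprSr mulrA vabs_lambert_coefX//.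
rewrite vabs_nat_coprime; last first.
  rewrite prime_coprime// -addn1 dvdn_addr ?dvdn1 ?dvdn_exp//.
  by rewrite neq_ltn prime_gt1 ?orbT.
rewrite expr1n mul1r/= expr2 ler_pM2r// -[leLHS]expr1.
rewrite ler_wiXn2l ?(ltW rho0) ?(ltW rho1)// leq_subLR.
rewrite factS lognM ?fact_gt0// mulnDr -addnA.
apply: leq_trans (leq_addl _ _).
by rewrite addn1 -[leqLHS]prednK ?expn_gt0 ?prime_gt0// ltnS logn_fact_pow_lb.
Qed.

(** * Comparison of the monomials *)

Lemma vabs_lambert_term_le (r : R) n : (0 < n)%N -> 0 <= r ->
  ||a n||_p * r ^+ n <= r * (r / rho) ^+ n.-1.
Proof.
move=> n0 r0; have rho0 := padic_radius_gt0.
have -> : ||a n||_p * r ^+ n =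
    ||a n||_p * rho ^+ n.-1 * (r * (r / rho) ^+ n.-1).
  rewrite mulrCA -mulrA -exprMn [rho * _]mulrC divfK ?gt_eqF// mulrCA -exprS.
  by rewrite prednK.
rewrite ler_piMl ?mulr_ge0 ?exprn_ge0 ?divr_ge0 ?(ltW rho0)//.
have [n1|] := ltnP 1 n; first exact/ltW/vabs_lambert_coef_lt1.
by case: n n0 => [|[|]]// _ _; rewrite lambert_coef1 vabs1 mul1r.
Qed.

Lemma vabs_lambert_term_lt (r : R) n : n <> 1%N -> 0 < r -> r <= rho ->
  ||a n||_p * r ^+ n < r.
Proof.
case: n => [|[|n]]// _ r0 rrho; first by rewrite lambert_coef0 vabs0 mul0r.
rewrite exprSr mulrA gtr_pMl//.
apply: le_lt_trans (vabs_lambert_coef_lt1 (n := n.+2) isT).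
by rewrite ler_wpM2l ?vabs_ge0// lerXn2r// nnegrE ltW// padic_radius_gt0.
Qed.

Lemma cvgn_lambert (x : K) : ||x||_p < rho -> cvgn (power_series a x).
Proof.
move=> xrho; apply: vabs_lt_cvgn_series; first exact: padic_complete.
have rho0 := padic_radius_gt0.
have q0 : 0 <= ||x||_p / rho by rewrite divr_ge0 ?vabs_ge0 ?ltW.
have q1 : ||x||_p / rho < 1 by rewrite ltr_pdivrMr// mul1r.
move=> e /(expr_lt_small q0 q1)[N Nq]; exists N.+1 => -[//|n] Nn.
rewrite vabsM vabsX (le_lt_trans (vabs_lambert_term_le _ (vabs_ge0 _)))//=.
apply: le_lt_trans (Nq n Nn); rewrite ler_piMl ?exprn_ge0//.
by rewrite ltW// (lt_trans xrho)// padic_radius_lt1.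
Qed.

Lemma not_cvgn_lambert (x : K) : rho <= ||x||_p -> ~ cvgn (power_series a x).
Proof.
move=> xrho cx; have rho0 := padic_radius_gt0.
have [N Na] := cvgn_series_vabs_lt cx (exprn_gt0 2 rho0).
have Np : (N <= (p ^ N.+1).+1)%N.
  by rewrite leqW// ltnW// ltnW// ltn_expl// prime_gt1.
have := Na _ Np; rewrite vabsM vabsX ltNge => /negP; apply.
apply: le_trans (@vabs_lambert_coef_pow_succ N.+1 isT) _.
rewrite ler_wpM2l ?vabs_ge0//.
by rewrite lerXn2r// nnegrE ?vabs_ge0// ltW.
Qed.

(** For [x] nonzero, every partial sum of at least two terms is [x] plus terms
    strictly smaller than [x]. *)
Lemma vabs_lambertW (x : K) : ||x||_p < rho -> ||lambertW x||_p = ||x||_p.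
Proof.
move=> xrho; apply: (@vabs_cvg_cst _ _ _ _ _ 2%N (cvgn_lambert xrho)) => n n2.
rewrite /power_series /series/= big_ltn ?(ltnW n2)// big_ltn//.
rewrite lambert_coef0 mul0r add0r lambert_coef1 mul1r expr1.
have [->|x0] := eqVneq x 0.
  by rewrite add0r big_nat_cond big1// => i /andP[/andP[i2 _] _];
    rewrite expr0n gtn_eqF ?mulr0// ltnW.
have vx0 : 0 < ||x||_p.
  by rewrite lt_def vabs_ge0 andbT; apply: contraNneq x0 => /vabs0_eq0 ->.
apply: vabsD_isosceles; rewrite big_seq_cond; apply: vabs_sum_lt => // i.
rewrite mem_index_iota andbT vabsM vabsX => /andP[i2 _].
by apply: vabs_lambert_term_lt; rewrite ?(ltW xrho)// => i1; rewrite i1 in i2.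
Qed.

(** Beyond [rho] the monomials of degree [p ^ k + 1] are unbounded, which rules
    out a dominant one. *)
Lemma lambert_term_unbounded (r C : R) : rho < r ->
  ~ (forall k, ||a k||_p * r ^+ k <= C).
Proof.
move=> rhor aC; have rho0 := padic_radius_gt0; have r0 := lt_trans rho0 rhor.
have C0 : 0 < C.
  by apply: lt_le_trans (aC 1%N); rewrite lambert_coef1 vabs1 mul1r expr1.
have q0 : 0 <= rho / r by rewrite divr_ge0 ?ltW.
have q1 : rho / r < 1 by rewrite ltr_pdivrMr// mul1r.
have [N /(_ (p ^ N.+1).+1) Nq] :=
  expr_lt_small q0 q1 (divr_gt0 (exprn_gt0 2 rho0) C0).
have {Nq} : (rho / r) ^+ (p ^ N.+1).+1 < rho ^+ 2 / C.
  by apply: Nq; rewrite leqW// ltnW// ltnW// ltn_expl// prime_gt1.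
rewrite ltr_pdivlMr// ltNge => /negP; apply.
apply: (le_trans (@vabs_lambert_coef_pow_succ N.+1 isT)).
set n := (p ^ N.+1).+1.
rewrite -[in leLHS](divfK (lt0r_neq0 r0) rho) exprMn mulrCA.
by rewrite ler_wpM2l ?exprn_ge0.
Qed.

Lemma lambert_no_critical_radius (r : R) : ~ critical_radius a r.
Proof.
move=> [r0 [n [m [nm Enm dom]]]].
have [rrho|rhor] := leP r rho; last exact: lambert_term_unbounded rhor dom.
have dom1 : r <= ||a n||_p * r ^+ n.
  by apply: le_trans (dom 1%N); rewrite lambert_coef1 vabs1 mul1r expr1.
have deg1 k : r <= ||a k||_p * r ^+ k -> k = 1%N.
  move=> rk; apply: contrapT => k1.
  by move: rk; rewrite leNgt vabs_lambert_term_lt.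
by apply: nm; rewrite (deg1 n)// (deg1 m)// -Enm.
Qed.

End Lambert.

Theorem theorem1 (p : nat) (p_prime : prime p) (R : realType)
    (K : padicOmega p R) :
  [/\ (forall x : K, ||x||_p < padic_radius p R ->
         cvgn (power_series (lambert_coef K) x))
      /\ (forall x : K, ~ (||x||_p < padic_radius p R) ->
         ~ cvgn (power_series (lambert_coef K) x)),
      forall x : K, ||x||_p < padic_radius p R -> ||lambertW x||_p = ||x||_p,
      forall x : K, ||x||_p < padic_radius p R -> (lambertW x = 0 <-> x = 0),
      forall r : R, 0 < r -> r < padic_radius p R ->
        is_max [set ||lambert_coef K n||_p * r ^+ n | n in [set n | (1 <= n)%N]] r &
      forall r : R, ~ critical_radius (lambert_coef K) r].
Proof.
split.
- split=> x; first exact: cvgn_lambert.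
  by move=> /negP; rewrite -leNgt; exact: not_cvgn_lambert.
- exact: vabs_lambertW.
- move=> x /(vabs_lambertW p_prime) Wx.
  by split=> E; apply: vabs0_eq0; move: Wx; rewrite E vabs0.
- move=> r r0 rrho; split.
    by exists 1%N => //; rewrite lambert_coef1 vabs1 mul1r expr1.
  move=> _ [n _ <-]; have [->|/eqP n1] := eqVneq n 1%N.
    by rewrite lambert_coef1 vabs1 mul1r expr1.
  exact/ltW/(vabs_lambert_term_lt p_prime K n1 r0 (ltW rrho)).
- exact: lambert_no_critical_radius.
Qed.
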